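(* Let $g:\mathcal{Z}\to\mathcal{Z}^*$ be an operator, $r:\mathcal{Z}\to\mathbb{R}$ convex, $z_0\in\mathcal{Z}$, and assume that $g$ is $\frac1\eta$-relaxed relatively Lipschitz with respect to $r$ for some $\eta>0$. Let $T\in\mathbb{N}$ and define, for $t=0,1,\dots,T-1$, $$w_t=\mathrm{Prox}^r_{z_t}(\eta g(z_t)),\qquad z_{t+1}=\mathrm{Prox}^r_{z_t}\left(\tfrac{\eta}{2}g(w_t)\right).$$ Then for any $u\in\mathcal{Z}$, $$\frac1T\sum_{t=0}^{T-1}\langle g(w_t),w_t-u\rangle\le\frac{2}{\eta T}V^r_{z_0}(u).$$
   Context: $\mathcal{Z}$ is a convex set and $\mathcal{Z}^*$ denotes the dual space. For a differentiable convex function $r$, the Bregman divergence is $V^r_x(x')=r(x')-r(x)-\langle\nabla r(x),x'-x\rangle$. For $z\in\mathcal{Z}$ and $g\in\mathcal{Z}^*$, the proximal oracle $\mathrm{Prox}^r_z(g)$ outputs $\arg\min_{w\in\mathcal{Z}}\langle g,w\rangle+V^r_z(w)$. The operator $g:\mathcal{Z}\to\mathcal{Z}^*$ is $\frac1\eta$-relaxed relatively Lipschitz with respect to $r$ if for all $(z,z',z^+)\in\mathcal{Z}\times\mathcal{Z}\times\mathcal{Z}$, $\eta\langle g(z')-g(z),z'-z^+\rangle\le V^r_z(z')+V^r_{z'}(z^+)+V^r_z(z^+)$. *)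

(* Defs.v *)
From HB Require Import structures.
From mathcomp Require Import all_boot all_order all_algebra.
From mathcomp Require Import all_classical all_reals.
From mathcomp Require Import interval_inference topology normedtype landau.
From mathcomp Require Import derive convex.

Set Implicit Arguments.
Unset Strict Implicit.
Unset Printing Implicit Defensive.

Import Order.TTheory GRing.Theory Num.Theory.
Import numFieldNormedType.Exports.

Local Open Scope classical_set_scope.
Local Open Scope ring_scope.

(* The convex set lives in an arbitrary real normed space E.  Functions on Z
   are total functions on E whose values outside Z are never used; elements of
   the dual space are linear forms on E, their continuity being a separate
   hypothesis. *)

(* Fréchet differentiability relative to Z: the remainder estimate is only
   required along points of Z, so Z need not be open and the values of r
   outside Z are irrelevant. *)
Definition differentiable_in (R : realType) (E : normedModType R)
    (Z : set E) (r : E -> R^o) : Prop :=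
  forall x, Z x -> differentiable r (within Z (nbhs x)).

(* If Z has empty interior the relative differential need not be unique as a
   linear form on E.  For Z convex and x, x' in Z its value at x' - x does not
   depend on the choice: it is the one-sided derivative of r at x along the
   segment from x to x'. *)
Definition gradient_in (R : realType) (E : normedModType R)
    (Z : set E) (r : E -> R^o) (x : E) : {linear E -> R^o} :=
  'd r (within Z (nbhs x)).

Definition bregman (R : realType) (E : normedModType R)
    (Z : set E) (r : E -> R^o) (x x' : E) : R :=
  r x' - r x - gradient_in Z r x (x' - x).

(* The set of all minimizers: r is not assumed strictly convex, so neither
   existence nor uniqueness is built in.  An output of the oracle is any element
   of this set. *)
Definition prox (R : realType) (E : normedModType R)
    (Z : set E) (r : E -> R^o) (z : E) (l : {linear E -> R^o}) : set E :=
  [set w | Z w /\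
     forall v, Z v -> l w + bregman Z r z w <= l v + bregman Z r z v].

(* The Lipschitz constant is 1 / eta; the parameter is eta itself. *)
Definition relaxed_relatively_lipschitz (R : realType) (E : normedModType R)
    (Z : set E) (r : E -> R^o) (eta : R) (g : E -> {linear E -> R^o}) : Prop :=
  forall z z' zp : E, Z z -> Z z' -> Z zp ->
    eta * (g z' \- g z) (z' - zp) <=
    bregman Z r z z' + bregman Z r z' zp + bregman Z r z zp.

(* Main.v *)
Require Import Defs.
From HB Require Import structures.
From mathcomp Require Import all_boot all_order all_algebra.
From mathcomp Require Import all_classical all_reals.
From mathcomp Require Import interval_inference topology normedtype landau.
From mathcomp Require Import derive convex.
From mathcomp Require Import ring lra.

Set Implicit Arguments.
Unset Strict Implicit.
Unset Printing Implicit Defensive.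

Import Order.TTheory GRing.Theory Num.Theory.
Import numFieldNormedType.Exports.

Local Open Scope classical_set_scope.
Local Open Scope ring_scope.

(** The theorem is the mirror-prox (extragradient) regret bound: each iteration
pays for its regret with a drop of the potential [bregman Z r (z t) u].

Every output [w] of the oracle at [z] for a linear form [l] satisfies the
three-point inequality ([prox_three_points])
  l (w - u) <= V_z(u) - V_w(u) - V_z(w)   for all u in Z.
Apply it to the step z -> w (with l = eta g(z), tested at the next iterate z+)
and to the step z -> z+ (with l = eta/2 g(w), tested at u), and add the
relaxed Lipschitz inequality at (z, w, z+).  The first application and the
Lipschitz inequality combine into
  eta <g(w), w - z+> <= 2 V_z(z+):
the terms V_w(z+) and V_z(w) cancel.  Twice the second application absorbs
2 V_z(z+) exactly, which leaves
  eta <g(w), w - u> <= 2 (V_z(u) - V_z+(u))   ([extragradient_step]).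
Summing over the iterations telescopes, and the last term V_{z_T}(u) is
nonnegative because r is convex ([bregman_ge0]).

Both the three-point inequality and the nonnegativity of V are first-order
facts along segments of Z.  Since r is only differentiable relative to Z, the
one link between the gradient and the values of r is that, for x and y in Z,
the gradient at x evaluated at y - x is the one-sided derivative of r along the
segment ([gradient_in_segment]); the two facts follow by letting s tend to 0
from the right in an inequality between values of r. *)

(** Relative differentiability is phrased with the base point [lim] of the
restricted filter; membership of x in Z makes that filter proper, so that x is
its unique limit. *)
Lemma lim_within (R : realType) (E : normedModType R) (Z : set E) (x : E) :
  Z x -> lim (within Z (nbhs x)) = x.
Proof.
move=> Zx.
have PF : ProperFilter (within Z (nbhs x)).
  by apply: within_nbhs_proper; exact: subset_closure.
apply: (@cvg_lim E (@norm_hausdorff R E) _ (within Z (nbhs x)) PF idfun).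
exact: cvg_within.
Qed.

Lemma gradient_in_expansion (R : realType) (E : normedModType R) (Z : set E)
    (r : E -> R^o) (x : E) (e : R) :
  differentiable_in Z r -> Z x -> 0 < e ->
  \forall y \near within Z (nbhs x),
    `|r y - (r x + gradient_in Z r x (y - x))| <= e * `|y - x|.
Proof.
move=> dr Zx e0; have [[_]] := dr _ Zx.
rewrite [lim _](lim_within Zx) => /eqaddoP /(_ e e0).
exact.
Qed.

Lemma segment_conv (R : realType) (E : normedModType R) (x y : E) (s : {i01 R}) :
  x + s%:num *: (y - x) = conv s (y : convex_lmodType E) x.
Proof.
rewrite [RHS](_ : _ = s%:num *: y + (1 - s%:num) *: x) //.
by rewrite scalerBl scale1r scalerBr addrCA.
Qed.

Lemma convex_set_segment (R : realType) (E : normedModType R) (Z : set E)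
    (x y : E) (s : R) :
  convex_set Z -> Z x -> Z y -> 0 <= s -> s <= 1 -> Z (x + s *: (y - x)).
Proof.
move=> cZ Zx Zy s0 s1; apply/set_mem.
by rewrite (segment_conv x y (Itv01 s0 s1)); apply: cZ; exact/mem_set.
Qed.

Lemma convex_function_segment (R : realType) (E : normedModType R)
    (Z : set E) (r : E -> R^o) (x y : E) (s : R) :
  convex_function Z r -> Z x -> Z y -> 0 <= s -> s <= 1 ->
  r (x + s *: (y - x)) <= r x + s * (r y - r x).
Proof.
move=> cr Zx Zy s0 s1.
rewrite (segment_conv x y (Itv01 s0 s1)).
have := cr (Itv01 s0 s1) y x (mem_set Zy) (mem_set Zx).
rewrite convRE /= => /le_trans; apply; rewrite mulrBl mulrBr; lra.
Qed.

(** Convexity keeps the whole segment inside Z, so the expansion of r relative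
to Z may be used along it. *)
Lemma gradient_in_segment (R : realType) (E : normedModType R) (Z : set E)
    (r : E -> R^o) (x y : E) :
  convex_set Z -> differentiable_in Z r -> Z x -> Z y ->
  s^-1 * (r (x + s *: (y - x)) - r x) @[s --> (0:R)^'+] -->
  (gradient_in Z r x (y - x) : R).
Proof.
move=> cZ dr Zx Zy.
have to_x : x + s *: (y - x) @[s --> (0:R)^'+] --> x.
  apply: cvg_at_right_filter; rewrite -[X in _ --> X]addr0.
  apply: cvgD; first exact: cvg_cst.
  by rewrite -(scale0r (y - x)); apply: cvgZr_tmp; exact: cvg_id.
have in_Z : \forall s \near (0:R)^'+, Z (x + s *: (y - x)).
  near=> s; apply: convex_set_segment => //; near: s.
  exact: nbhs_right_le.
apply/cvgrPdist_le => e e0.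
(* The 1 keeps the denominator positive when y = x. *)
pose d := e / (1 + `|y - x|).
have n0 : 0 < 1 + `|y - x| by rewrite ltr_pwDl.
have d0 : 0 < d by rewrite divr_gt0.
have est : \forall s \near (0:R)^'+, Z (x + s *: (y - x)) ->
    `|r (x + s *: (y - x)) - (r x + gradient_in Z r x (x + s *: (y - x) - x))|
      <= d * `|x + s *: (y - x) - x|.
  exact: to_x _ (gradient_in_expansion dr Zx d0).
move: est; apply: filter_app; near=> s => est_s.
have s0 : 0 < s by [].
have Zs : Z (x + s *: (y - x)) by near: s.
move: (est_s Zs); rewrite [_ + _ - x]addrC addKr normrZ linearZ /=.
rewrite /GRing.scale /= (gtr0_norm s0) => {}est_s.
rewrite distrC -(ler_pM2l s0) -[X in X * `|_|](gtr0_norm s0) -normrM mulrBr.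
rewrite mulVKf ?gt_eqF // -addrA -opprD; apply: (le_trans est_s).
rewrite mulrCA ler_pM2l // mulrAC ler_pdivrMr // ler_pM2l //.
by rewrite lerDr.
Unshelve. all: by end_near. Qed.

(** The difference quotients of the convex r along the segment from x to y
never exceed r y - r x, hence neither does their limit. *)
Lemma bregman_ge0 (R : realType) (E : normedModType R) (Z : set E)
    (r : E -> R^o) (x y : E) :
  convex_set Z -> convex_function Z r -> differentiable_in Z r ->
  Z x -> Z y -> 0 <= bregman Z r x y.
Proof.
move=> cZ cr dr Zx Zy; rewrite /bregman subr_ge0.
apply: (cvgr_to_le (gradient_in_segment cZ dr Zx Zy)).
near=> s; rewrite ler_pdivrMl; last by [].
rewrite lerBlDl; apply: convex_function_segment => //.
by near: s; exact: nbhs_right_le.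
Unshelve. all: by end_near. Qed.

(** The variational inequality of the oracle.  The minimizer w may lie
on the boundary of Z, so the derivative of the objective there need not vanish:
it is merely nonnegative in the feasible direction u - w. *)
Lemma prox_first_order (R : realType) (E : normedModType R) (Z : set E)
    (r : E -> R^o) (l : {linear E -> R^o}) (z w u : E) :
  convex_set Z -> differentiable_in Z r -> Z u ->
  prox Z r z l w ->
  gradient_in Z r z (u - w) - l (u - w) <= gradient_in Z r w (u - w).
Proof.
move=> cZ dr Zu [Zw minw].
apply: (cvgr_to_ge (gradient_in_segment cZ dr Zw Zu)).
near=> s; rewrite ler_pdivlMl; last by [].
have Zv : Z (w + s *: (u - w)).
  by apply: convex_set_segment => //; near: s; exact: nbhs_right_le.
have := minw _ Zv; rewrite /bregman [w + _ - z]addrAC !linearD !linearZ /=.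
rewrite !linearN /= /GRing.scale /=; lra.
Unshelve. all: by end_near. Qed.

(** The right-hand side is the difference of the gradients at w and at z,
applied to u - w: all values of r cancel. *)
Lemma prox_three_points (R : realType) (E : normedModType R) (Z : set E)
    (r : E -> R^o) (l : {linear E -> R^o}) (z w u : E) :
  convex_set Z -> differentiable_in Z r -> Z u ->
  prox Z r z l w ->
  l (w - u) <= bregman Z r z u - bregman Z r w u - bregman Z r z w.
Proof.
move=> cZ dr Zu wP; have := prox_first_order cZ dr Zu wP.
rewrite /bregman !linearB /=; lra.
Qed.

(** One iteration trades its regret against u for a decrease of the divergence
to u. *)
Lemma extragradient_step (R : realType) (E : normedModType R) (Z : set E)
    (g : E -> {linear E -> R^o}) (r : E -> R^o) (eta : R) (z w zp u : E) :
  convex_set Z -> differentiable_in Z r ->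
  relaxed_relatively_lipschitz Z r eta g ->
  prox Z r z (eta \*: g z) w -> prox Z r z ((eta / 2) \*: g w) zp ->
  Z z -> Z u ->
  eta * g w (w - u) <= 2 * (bregman Z r z u - bregman Z r zp u).
Proof.
move=> cZ dr Lg wP zpP Zz Zu.
have [Zw _] := wP; have [Zzp _] := zpP.
have := prox_three_points cZ dr Zzp wP.
have := prox_three_points cZ dr Zu zpP.
have := Lg _ _ _ Zz Zw Zzp.
rewrite /= /GRing.scale /= !(linearB (g _)) /=; lra.
Qed.

Theorem proposition3 (R : realType) (E : normedModType R) (Z : set E)
    (g : E -> {linear E -> R^o}) (r : E -> R^o) (z0 : E) (eta : R) (T : nat)
    (w z : nat -> E) :
  convex_set Z ->
  (forall x, Z x -> continuous (g x)) ->
  convex_function Z r ->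
  differentiable_in Z r ->
  Z z0 ->
  0 < eta ->
  relaxed_relatively_lipschitz Z r eta g ->
  (0 < T)%N ->
  z 0%N = z0 ->
  (forall t, (t < T)%N -> prox Z r (z t) (eta \*: g (z t)) (w t)) ->
  (forall t, (t < T)%N -> prox Z r (z t) ((eta / 2) \*: g (w t)) (z t.+1)) ->
  forall u, Z u ->
    T%:R^-1 * (\sum_(t < T) g (w t) (w t - u)) <=
    2 / (eta * T%:R) * bregman Z r z0 u.
Proof.
move=> cZ _ cr dr Zz0 eta0 Lg T0 z0E wP zP u Zu.
have Zz t : (t <= T)%N -> Z (z t).
  by case: t => [|t] tT; [rewrite z0E | have [] := zP _ tT].
have step t : (t < T)%N ->
    eta * g (w t) (w t - u) <=
    2 * (bregman Z r (z t) u - bregman Z r (z t.+1) u).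
  by move=> tT; exact: (extragradient_step cZ dr Lg (wP t tT) (zP t tT)
    (Zz _ (ltnW tT)) Zu).
have regret : eta * (\sum_(t < T) g (w t) (w t - u)) <= 2 * bregman Z r z0 u.
  rewrite mulr_sumr; apply: (@le_trans _ _
    (\sum_(t < T) 2 * (bregman Z r (z t) u - bregman Z r (z t.+1) u))).
    by apply: ler_sum => t _; exact: step.
  rewrite -mulr_sumr ler_pM2l //.
  under eq_bigr do rewrite -opprB.
  rewrite sumrN -(big_mkord xpredT
    (fun t => bregman Z r (z t.+1) u - bregman Z r (z t) u)).
  rewrite telescope_sumr // opprB z0E gerBl.
  exact: bregman_ge0 (Zz _ (leqnn T)) Zu.
have TR0 : 0 < T%:R :> R by rewrite ltr0n.
rewrite invfM (_ : 2 * _ * _ = T%:R^-1 * (eta^-1 * (2 * bregman Z r z0 u)));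
  last by ring.
by rewrite ler_pM2l ?invr_gt0 // ler_pdivlMl.
Qed.
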